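(* Let $\Omega=\{1,\dots,n\}$ be the set of regulation resources, with cost parameters $a_i>0$, undirected communication graph $G$ on $\Omega$, tuning parameter $\beta>0$, and time slots $\mathcal{T}=\{1,\dots,T\}$. Suppose the control signals $u_i(t)$ are generated by the distributed control scheme described in the context, driven by the load deviations $\Delta P_L(t)$ and the resources' regulation contributions $\Delta P_m^i(t)$. Then the scheme satisfies the necessary condition that the control signals sum to the load deviation: for every time step $t\to t+1$ of the scheme, $$\sum_{i\in\Omega} u_i(t+1)=\Delta P_L(t+1).$$
   Context: There are $n$ frequency regulation resources, indexed by $\Omega=\{1,\dots,n\}$. At time slot $t$, $\Delta P_L(t)\in\mathbb{R}$ is the deviation of the load from its predicted value, $\Delta P_m^i(t)\in\mathbb{R}$ is the regulation contribution (mechanical power deviation) of resource $i$, and $u_i(t)\in\mathbb{R}$ is the secondary frequency control signal of resource $i$. Resource $i$ has a quadratic cost coefficient $a_i>0$. The resources communicate over an undirected graph $G$ on $\Omega$; $\Omega_i$ denotes the set of neighbors of $i$ in $G$ (so $l\in\Omega_i$ iff $i\in\Omega_l$). The real number $\beta>0$ is a tuning parameter. Distributed control scheme (consensus-plus-global-innovation): each resource $i$ keeps a local marginal-cost variable $\lambda_i^t$, tied to its actual contribution by $\lambda_i^t=2a_i\,\Delta P_m^i(t)$ at every time slot $t$, and in the step from $t$ to $t+1$ performs $$\tilde\lambda_i^{t+1}=\lambda_i^t-2a_i\beta\sum_{l\in\Omega_i}(\lambda_i^t-\lambda_l^t)+\frac{2a_i}{n}\Bigl(\Delta P_L(t+1)-\sum_{j\in\Omega}\Delta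 P_m^j(t)\Bigr),$$ $$u_i(t+1)=\frac{1}{2a_i}\tilde\lambda_i^{t+1},\qquad \lambda_i^{t+1}=2a_i\,\Delta P_m^i(t+1).$$ The contributions $\Delta P_m^i(t+1)$ are produced by the physical (governor-turbine) response of the resources and need not equal $u_i(t+1)$. *)

(* Defs.v *)
From HB Require Import structures.
From mathcomp Require Import all_boot all_order all_algebra.
From mathcomp Require Import reals.

Set Implicit Arguments.
Unset Strict Implicit.
Unset Printing Implicit Defensive.

Import Order.TTheory GRing.Theory Num.Theory.

Local Open Scope ring_scope.

(* Resources are numbered 0, ..., n-1; time-dependent quantities are functions
   on nat, constrained only on the slots 1, ..., T.  [G i l] says that l is a
   neighbour of i.  [Pm] is an arbitrary input: nothing forces [Pm t.+1 i] to
   equal [u t.+1 i].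
   The assignment of the new marginal cost lambda^(t+1) = 2 a_i Pm(t+1) at the
   end of a step is the instance of [marginal_cost] at slot t+1. *)
Record distributed_control (R : realType) (n T : nat) (a : 'I_n -> R)
    (G : rel 'I_n) (beta : R) (PL : nat -> R) (Pm u : nat -> 'I_n -> R)
    (lambda lambdat : nat -> 'I_n -> R) : Prop := DistributedControl {
  marginal_cost : forall (t : nat) (i : 'I_n), (1 <= t <= T)%N ->
    lambda t i = 2 * a i * Pm t i;
  consensus_innovation : forall (t : nat) (i : 'I_n), (1 <= t < T)%N ->
    lambdat t.+1 i = lambda t i
      - 2 * a i * beta * (\sum_(l < n | G i l) (lambda t i - lambda t l))
      + 2 * a i / n%:R * (PL t.+1 - \sum_(j < n) Pm t j);
  control_signal : forall (t : nat) (i : 'I_n), (1 <= t < T)%N ->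
    u t.+1 i = 1 / (2 * a i) * lambdat t.+1 i
}.

(* Main.v *)
Require Import Defs.
From HB Require Import structures.
From mathcomp Require Import all_boot all_order all_algebra.
From mathcomp Require Import reals.
From mathcomp Require Import ring.

Set Implicit Arguments.
Unset Strict Implicit.
Unset Printing Implicit Defensive.

Import Order.TTheory GRing.Theory Num.Theory.

Local Open Scope ring_scope.

(** In terms of the contributions, a step of the scheme reads
      u_i(t+1) = Pm_i(t) - beta * sum_(l ~ i) (lambda_i - lambda_l)
                 + (PL(t+1) - sum_j Pm_j(t)) / n.
    Summed over the resources, the consensus terms cancel in pairs because the
    graph is undirected ([sum_neighbor_diff_eq0]), and the n equal shares of
    the global innovation add up to PL(t+1) - sum_j Pm_j(t), which replaces
    the total contribution sum_j Pm_j(t) by PL(t+1). *)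

(** The graph Laplacian of an undirected graph has zero column sums. *)
Lemma sum_neighbor_diff_eq0 (V : zmodType) (I : finType) (G : rel I)
    (x : I -> V) :
  symmetric G -> \sum_i \sum_(l | G i l) (x i - x l) = 0.
Proof.
move=> G_sym.
under eq_bigr do rewrite sumrB.
rewrite sumrB [X in _ - X](exchange_big_dep xpredT) //=.
apply/eqP; rewrite subr_eq0; apply/eqP.
by apply: eq_bigr => i _; apply: eq_bigl => l; rewrite G_sym.
Qed.

Theorem theorem1 (R : realType) (n T : nat) (a : 'I_n -> R) (G : rel 'I_n)
    (beta : R) (PL : nat -> R) (Pm u lambda lambdat : nat -> 'I_n -> R)
    (n_gt0 : (0 < n)%N)
    (a_gt0 : forall i : 'I_n, 0 < a i)
    (G_sym : symmetric G)
    (beta_gt0 : 0 < beta)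
    (scheme : distributed_control T a G beta PL Pm u lambda lambdat) :
  forall t : nat, (1 <= t < T)%N -> \sum_(i < n) u t.+1 i = PL t.+1.
Proof.
move=> t /andP[t_ge1 t_ltT].
have uE i : u t.+1 i = Pm t i
    - beta * (\sum_(l < n | G i l) (lambda t i - lambda t l))
    + (PL t.+1 - \sum_(j < n) Pm t j) / n%:R.
  rewrite (control_signal scheme) ?(consensus_innovation scheme) ?t_ge1 //.
  (* Only the isolated lambda t i is expanded: the consensus sum is kept in
     terms of lambda, where its terms cancel in pairs. *)
  rewrite [X in X - _](marginal_cost scheme) ?t_ge1 ?(ltnW t_ltT) //.
  have a_neq0 := lt0r_neq0 (a_gt0 i).
  have n_neq0 : n%:R != 0 :> R by rewrite pnatr_eq0 -lt0n.
  by field; rewrite a_neq0 n_neq0.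
under eq_bigr do rewrite uE.
rewrite big_split sumrB -mulr_sumr sum_neighbor_diff_eq0 // mulr0 subr0 /=.
rewrite sumr_const card_ord -[X in _ + X]mulr_natr divfK ?pnatr_eq0 -?lt0n //.
by rewrite addrC subrK.
Qed.
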